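(* Let $q>0$ and let $f^t$ be a time-dependent family of mean-zero functions in $L^2(\mathbb{T}^d)$ with $\|f^t\|_{\dot H^{-q}}>0$ for all $t>0$. Then $f^t$ is $q$-recurrent if and only if there is a function $g\in \dot H^{q}$ such that $$\limsup_{t\to\infty}\frac{|\langle f^t,g\rangle|}{\|f^t\|_{\dot H^{-q}}}>0 .$$
   Context: $\mathbb{T}^d$ is the $d$-dimensional torus (period $1$ in each coordinate). Time $t$ ranges over $[0,\infty)$ or over the nonnegative integers, and for each $t$ the function $f^t=f(t,\cdot)$ is given; no evolution equation is imposed. Fourier coefficients: $f_{\mathbf{k}}=\int_{\mathbb{T}^d} f(\mathbf{x})e^{-2\pi i\,\mathbf{x}\cdot\mathbf{k}}\,d\mathbf{x}$ for $\mathbf{k}\in\mathbb{Z}^d$, and $k=|\mathbf{k}|$ denotes the Euclidean norm. Mean-zero means $f_{\mathbf{0}}=0$. For $\alpha\in\mathbb{R}$, $\|f\|_{\dot H^{\alpha}}=\big(\sum_{\mathbf{k}\neq \mathbf{0}}k^{2\alpha}|f_{\mathbf{k}}|^2\big)^{1/2}$, and $\dot H^\alpha$ is the space of mean-zero $f$ on $\mathbb{T}^d$ for which this is finite. The pairing is $\langle f,g\rangle=\sum_{\mathbf{k}}f_{\mathbf{k}}\overline{g_{\mathbf{k}}}$ (the $L^2$ inner product). For $I\subset\mathbb{Z}^d$, $P_If^t=\sum_{\mathbf{k}\in I}f^t_{\mathbf{k}}e^{2\pi i\,\mathbf{x}\cdot\mathbf{k}}$. Definition: $f^t$ is $q$-recurrent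 if there exists a finite set $I\subset\mathbb{Z}^d$ such that $\limsup_{t\to\infty}\dfrac{\|P_If^t\|_{\dot H^{-q}}}{\|f^t\|_{\dot H^{-q}}}>0$. *)

(* Defs.v *)
From HB Require Import structures.
From mathcomp Require Import all_boot all_order all_algebra finmap.
From mathcomp Require Import complex.
From mathcomp Require Import all_classical all_reals all_analysis.
From mathcomp Require summability.
Set Implicit Arguments.
Unset Strict Implicit.
Unset Printing Implicit Defensive.
Import Order.TTheory GRing.Theory Num.Theory.
Import numFieldNormedType.Exports.
Import ComplexField.Normc.
Local Open Scope classical_set_scope.
Local Open Scope ring_scope.
Local Open Scope complex_scope.

Section CubeMeasure.
Variable R : realType.

Definition cons_point (d : nat) (p : measurableTypeR R * d.-tuple R) :
    d.+1.-tuple R := [the d.+1.-tuple R of p.1 :: p.2].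

Lemma measurable_cons_point (d : nat) :
  measurable_fun [set: measurableTypeR R * d.-tuple R] (@cons_point d).
Proof.
apply: measurable_cons; [exact: measurable_fst | exact: measurable_snd].
Qed.

HB.instance Definition _ (d : nat) :=
  isMeasurableFun.Build _ _ _ _ (@cons_point d) (@measurable_cons_point d).

(* d-dimensional Lebesgue measure restricted to the unit cube [0,1]^d, as an
   iterated product; [uniform_prob 0 1] is Lebesgue measure restricted to
   [0,1]. *)
Fixpoint cube_measure (d : nat) : probability (d.-tuple R) R :=
  match d with
  | 0%N => [the probability _ R of \d_([tuple] : 0.-tuple R)]
  | d'.+1 =>
      [the probability _ R of
        distribution (uniform_prob (@ltr01 R) \x cube_measure d')%E
                     (@cons_point d')]
  end.

End CubeMeasure.

Section TorusFunctions.
Variables (R : realType) (d : nat).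
Implicit Types (f g : d.-tuple R -> R[i]) (k : 'rV[int]_d) (x : d.-tuple R).

(* Functions on the torus are the Z^d-periodic functions on R^d; the torus is
   integrated over its fundamental domain [0,1]^d. *)
Definition torus_periodic f : Prop :=
  forall x k, f [tuple tnth x i + (k 0 i)%:~R | i < d] = f x.

Definition torus_Lp (p : \bar R) f : Prop :=
  [/\ torus_periodic f,
      (fun x => complex.Re (f x)) \in Lfun (cube_measure R d) p &
      (fun x => complex.Im (f x)) \in Lfun (cube_measure R d) p].

Definition torus_integral f : R[i] :=
  (\int[cube_measure R d]_x complex.Re (f x)) +i* (\int[cube_measure R d]_x complex.Im (f x)).

Definition phase k x : R := 2 * pi * \sum_(i < d) tnth x i * (k 0 i)%:~R.

(* exp (2 pi i x.k) *)
Definition fourier_mode k x : R[i] := cos (phase k x) +i* sin (phase k x).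

Definition fourier_coef f k : R[i] :=
  torus_integral (fun x => f x * (fourier_mode k x)^*).

Definition mean_zero f : Prop := fourier_coef f 0 = 0.

Definition freq_norm k : R := Num.sqrt (\sum_(i < d) (k 0 i)%:~R ^+ 2).

Definition sobolev_norm (alpha : R) f : \bar R :=
  ((\esum_(k in [set k : 'rV[int]_d | k != 0%R])
      (freq_norm k `^ (2 * alpha) * normc (fourier_coef f k) ^+ 2)%:E)
    `^ 2^-1)%E.

(* Fourier coefficients are only meaningful for integrable functions.  For
   alpha >= 0 finiteness of the norm then forces square integrability, so no
   element of the homogeneous space is lost; for alpha < 0 this is only the part
   of the space that consists of integrable functions. *)
Definition in_Hdot (alpha : R) f : Prop :=
  [/\ torus_Lp 1%E f, mean_zero f & (sobolev_norm alpha f < +oo)%E].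

(* Unconditional sum, i.e. limit over the net of finite subsets of Z^d. *)
Definition complex_sum (a : 'rV[int]_d -> R[i]) : R[i] :=
  summability.sum (fun k => complex.Re (a k) : R^o) +i*
  summability.sum (fun k => complex.Im (a k) : R^o).

Definition pairing f g : R[i] :=
  complex_sum (fun k => fourier_coef f k * (fourier_coef g k)^*).

Definition freq_proj (I : {fset 'rV[int]_d}) f : d.-tuple R -> R[i] :=
  fun x => \sum_(k <- I) fourier_coef f k * fourier_mode k x.

End TorusFunctions.

Section Recurrence.
Variable R : realType.

Definition time_domain (T : set R) : Prop :=
  T = [set t : R | 0 <= t] \/ T = range (fun n : nat => n%:R : R).

(* limsup as t tends to infinity with t ranging over the time domain T *)
Definition limsup_time (T : set R) (u : R -> \bar R) : \bar R :=
  limf_esup u (within T (pinfty_nbhs R)).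

Definition recurrent (d : nat) (T : set R) (q : R)
    (f : R -> d.-tuple R -> R[i]) : Prop :=
  exists I : {fset 'rV[int]_d},
    (0 < limsup_time T (fun t =>
      sobolev_norm (- q) (freq_proj I (f t)) / sobolev_norm (- q) (f t)))%E.

End Recurrence.

(* Main.v *)
(* If [g] is in the homogeneous space of order [q], some finite [I] leaves a tail
   of [g] of norm at most [delta]; by Cauchy-Schwarz, [|<f, g>|] is then at most
   [||P_I f||_{-q} ||g||_q + delta ||f||_{-q}], so a pairing that is not
   negligible against [||f||_{-q}] forces [P_I f] not to be negligible either.
   Conversely [||P_I f||_{-q}] is controlled by the finitely many [|f_k|] with
   [k] in [I] nonzero, one of which is therefore not negligible, and the Fourier
   mode [g = e_k] has [<f, g> = f_k]. *)
Require Import Defs.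
From HB Require Import structures.
From mathcomp Require Import all_boot all_order all_algebra finmap.
From mathcomp Require Import complex.
From mathcomp Require Import all_classical all_reals all_analysis.
From mathcomp Require summability.
From mathcomp Require Import measurable_realfun.
From mathcomp Require Import ring lra.
Import Order.TTheory GRing.Theory Num.Theory.
Import numFieldNormedType.Exports.
Import ComplexField.Normc.
Local Open Scope classical_set_scope.
Local Open Scope ring_scope.
Local Open Scope complex_scope.

(** * Trigonometric integrals over the unit cube *)

Lemma cosD2pi_int {R : realType} (x : R) (n : int) : cos (x + 2 * pi * n%:~R) = cos x.
Proof.
have cosDn y (m : nat) : cos (y + 2 * pi * m%:R) = cos y :> R.
  elim: m => [|m IH]; first by rewrite mulr0 addr0.
  have -> : 2 * pi * m.+1%:R = 2 * pi * m%:R + pi *+ 2 :> R by ring.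
  by rewrite addrA cosD2pi.
case: n => m; first exact: cosDn.
by rewrite NegzE mulrNz -pmulrn mulrN -[LHS](cosDn _ m.+1) subrK.
Qed.

Lemma sinD2pi_int {R : realType} (x : R) (n : int) : sin (x + 2 * pi * n%:~R) = sin x.
Proof. by rewrite -!cosBpihalf addrAC cosD2pi_int. Qed.

Lemma bounded_integrable {R : realType} d (X : measurableType d)
    (P : probability X R) (h : X -> R) :
  measurable_fun setT h -> (forall x, `|h x| <= 1) -> P.-integrable setT (EFin \o h).
Proof.
move=> mh hb; apply: measurable_bounded_integrable => //.
  by rewrite (le_lt_trans (probability_le1 _ _))// ltry.
exists 1; split; first exact: num_real.
by move=> M M1 x _ /=; apply: le_trans (hb x) (ltW M1).
Qed.

(** Fubini for real-valued integrals: boundedness over probability measures makes [h] and all its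
    sections integrable, so the inner integrals are finite and [fine] loses nothing. *)
Lemma bounded_Rintegral_prod {R : realType} d1 d2 (X : measurableType d1)
    (Y : measurableType d2) (P : probability X R) (Q : probability Y R)
    (h : X * Y -> R) :
  measurable_fun setT h -> (forall x, `|h x| <= 1) ->
  \int[(P \x Q)%E]_z h z = \int[P]_x \int[Q]_y h (x, y).
Proof.
move=> mh hb; rewrite /Rintegral -integral12_prod_meas1; last exact: bounded_integrable.
congr fine; apply: eq_integral => x _.
rewrite /fubini_F /= fineK//; apply: integrable_fin_num => //.
by apply: bounded_integrable => //; apply: measurableT_comp => //.
Qed.


Lemma Rintegral_uniform01 {R : realType} (h : R -> R) :
  continuous h -> (forall x, `|h x| <= 1) ->
  \int[uniform_prob (@ltr01 R)]_x h x = \int[lebesgue_measure]_(x in `[0, 1]) h x.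
Proof.
move=> ch hb.
have mh : measurable_fun [set: measurableTypeR R] h.
  exact: continuous_measurable_fun.
have ih : lebesgue_measure.-integrable `[0, 1] (EFin \o h).
  apply: continuous_compact_integrable; first exact: segment_compact.
  exact: continuous_subspaceT.
have ic : lebesgue_measure.-integrable `[0, 1] (EFin \o cst (1 : R)).
  apply: continuous_compact_integrable; first exact: segment_compact.
  by apply: continuous_subspaceT => x; exact: cvg_cst.
(* Adding the constant 1 makes the integrand nonnegative, as the integral formula for the uniform
   law demands; the added integral is 1 on both sides. *)
apply: (@addIr _ (\int[uniform_prob (@ltr01 R)]_x (cst 1 x))).
rewrite -RintegralD//; last 2 first.
- exact: bounded_integrable.
- by apply: bounded_integrable => // x; rewrite normr1.
rewrite {1}/Rintegral integral_uniform; last 2 first.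
- by apply/measurable_EFinP; exact: measurable_funD.
- by move=> x; rewrite lee_fin -lerBlDr sub0r; have := hb x; rewrite ler_norml => /andP[].
rewrite subr0 invr1 mul1e -/(Rintegral _ _ _) RintegralD//.
rewrite Rintegral_cst// Rintegral_cst//.
congr (_ + _ * fine _); transitivity (1%E : \bar R); last exact/esym/probability_setT.
by rewrite /= lebesgue_measure_itv/= lte_fin ltr01 oppr0 adde0.
Qed.

(** Orthogonality in dimension one. For [n != 0] the antiderivatives [sin (w * x) / w] and
    [- cos (w * x) / w] agree at 0 and 1, since [w] is an integer multiple of the period. *)
Lemma Rintegral_cos_sin_2pi {R : realType} (n : int) :
  \int[uniform_prob (@ltr01 R)]_x cos (2 * pi * (x * n%:~R)) = (n == 0)%:R /\
  \int[uniform_prob (@ltr01 R)]_x sin (2 * pi * (x * n%:~R)) = 0.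
Proof.
pose w : R := 2 * pi * n%:~R.
have wE (x : R) : 2 * pi * (x * n%:~R) = w * x by rewrite /w; ring.
under eq_Rintegral do rewrite wE.
under [X in _ /\ X = _]eq_Rintegral do rewrite wE.
have lin_cont : continuous (fun x : R => w * x).
  by move=> x; apply: cvgM => //; exact: cvg_cst.
have cos_cont : continuous (fun x : R => cos (w * x)).
  by move=> x; apply: continuous_comp; [exact: lin_cont|exact: continuous_cos].
have sin_cont : continuous (fun x : R => sin (w * x)).
  by move=> x; apply: continuous_comp; [exact: lin_cont|exact: continuous_sin].
rewrite !Rintegral_uniform01//; [|by move=> x; exact: sin_max|by move=> x; exact: cos_max].
have [n0|n0] := eqVneq n 0.
  have w0 : w = 0 by rewrite /w n0 mulr0.
  under eq_Rintegral do rewrite w0 mul0r cos0.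
  under [X in _ /\ X = _]eq_Rintegral do rewrite w0 mul0r sin0.
  rewrite !Rintegral_cst//= mul0r mul1r lebesgue_measure_itv/= lte_fin ltr01 oppr0 adde0.
  by split.
have w0 : w != 0.
  by rewrite /w mulf_neq0 ?intr_eq0// mulf_neq0 ?pnatr_eq0// gt_eqF// pi_gt0.
have dlin (x : R) : is_derive x 1 (fun y => w * y) w.
  by apply: is_derive_eq; rewrite /GRing.scale/=; ring.
have dsin (x : R) : is_derive x 1 (fun y => sin (w * y) / w) (cos (w * x)).
  by apply: is_derive_eq; rewrite /GRing.scale/=; field.
have dcos (x : R) : is_derive x 1 (fun y => - cos (w * y) / w) (sin (w * x)).
  by apply: is_derive_eq; rewrite /GRing.scale/=; field.

have w1c : cos w = 1 by rewrite -[RHS]cos0 -(cosD2pi_int 0 n) add0r.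
have w1s : sin w = 0 by rewrite -[RHS](@sin0 R) -(sinD2pi_int 0 n) add0r.
have FTC (h H : R -> R) : (forall x : R, is_derive x 1 H (h x)) -> continuous h ->
    \int[lebesgue_measure]_(x in `[0, 1]) h x = H 1 - H 0.
  move=> dH ch; have cH : continuous H.
    by move=> x; apply/differentiable_continuous/derivable1_diffP; case: (dH x).
  rewrite /Rintegral (@continuous_FTC2 _ _ H)//.
  - exact: continuous_subspaceT.
  - split; first by move=> x _; case: (dH x).
      by apply: cvg_at_right_filter; exact: cH.
    by apply: cvg_at_left_filter; exact: cH.
  - by move=> x _; rewrite derive1E; case: (dH x).
rewrite (FTC _ _ dsin cos_cont) (FTC _ _ dcos sin_cont).
by rewrite !mulr1 !mulr0 w1c w1s cos0 sin0 !subrr.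
Qed.

Lemma phase_cons {R : realType} d (k : 'rV[int]_d.+1) (p : measurableTypeR R * d.-tuple R) :
  phase k (cons_point p) =
  2 * pi * (p.1 * (k 0 ord0)%:~R) + phase (\row_i k 0 (lift ord0 i)) p.2.
Proof.
rewrite /phase big_ord_recl mulrDr tnth0; congr (_ + _ * _).
by apply: eq_bigr => i _; rewrite tnthS mxE.
Qed.

Lemma measurable_phase {R : realType} d (k : 'rV[int]_d) :
  measurable_fun [set: d.-tuple R] (phase k).
Proof.
apply: measurable_funM => //; apply: measurable_sum => i.
by apply: measurable_funM => //; exact: measurable_tnth.
Qed.

Lemma measurable_cos_phase {R : realType} d (k : 'rV[int]_d) :
  measurable_fun [set: d.-tuple R] (cos \o phase k).
Proof.
apply: measurableT_comp; last exact: measurable_phase.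
by apply: continuous_measurable_fun; exact: continuous_cos.
Qed.

Lemma measurable_sin_phase {R : realType} d (k : 'rV[int]_d) :
  measurable_fun [set: d.-tuple R] (sin \o phase k).
Proof.
apply: measurableT_comp; last exact: measurable_phase.
by apply: continuous_measurable_fun; exact: continuous_sin.
Qed.

Lemma integrable_cos_phase {R : realType} d (k : 'rV[int]_d) :
  (cube_measure R d).-integrable setT (EFin \o (cos \o phase k)).
Proof.
by apply: bounded_integrable => [|x]; [exact: measurable_cos_phase|exact: cos_max].
Qed.

Lemma integrable_sin_phase {R : realType} d (k : 'rV[int]_d) :
  (cube_measure R d).-integrable setT (EFin \o (sin \o phase k)).
Proof.
by apply: bounded_integrable => [|x]; [exact: measurable_sin_phase|exact: sin_max].
Qed.

Lemma integrable_lincomb {R : realType} d (X : measurableType d)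
    (mu : measure X R) (a b : R) (f g : X -> R) :
  mu.-integrable setT (EFin \o f) -> mu.-integrable setT (EFin \o g) ->
  mu.-integrable setT (EFin \o (fun x => a * f x + b * g x)).
Proof.
move=> fi gi; have := integrableD measurableT (integrableZl measurableT a fi)
  (integrableZl measurableT b gi).
exact: eq_integrable.
Qed.

Lemma Rintegral_lincomb {R : realType} d (X : measurableType d)
    (mu : measure X R) (a b : R) (f g : X -> R) :
  mu.-integrable setT (EFin \o f) -> mu.-integrable setT (EFin \o g) ->
  \int[mu]_x (a * f x + b * g x) = a * \int[mu]_x f x + b * \int[mu]_x g x.
Proof.
move=> fi gi; rewrite RintegralD//; last 2 first.
- exact: integrableZl measurableT a _ fi.
- exact: integrableZl measurableT b _ gi.
by rewrite !RintegralZl.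
Qed.

(** The cube measure is an image measure of a product: change of variables along [cons_point], then
    Fubini. *)
Lemma Rintegral_cubeS {R : realType} d (h : d.+1.-tuple R -> R) :
  measurable_fun setT h -> (forall x, `|h x| <= 1) ->
  \int[cube_measure R d.+1]_z h z =
  \int[uniform_prob (@ltr01 R)]_x \int[cube_measure R d]_y h (cons_point (x, y)).
Proof.
move=> mh hb; pose H p := h (@cons_point R d p).
have mH : measurable_fun setT H by apply: measurableT_comp => //; exact: measurable_cons_point.
rewrite -(bounded_Rintegral_prod _ _ _ _ _ _ H)//.
rewrite /Rintegral integral_distribution//; first exact/measurable_EFinP.
- by apply: bounded_integrable => // x; exact: hb.
- by move=> x; exact: hb.
Qed.

Lemma row_eq0_cons d (k : 'rV[int]_d.+1) :
  (k == 0) = (k 0 ord0 == 0) && (\row_i k 0 (lift ord0 i) == 0).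
Proof.
apply/eqP/andP => [->|[/eqP k0 /eqP /rowP kS]].
  by rewrite mxE; split => //; apply/eqP/rowP => i; rewrite !mxE.
by apply/rowP => i; case: (unliftP ord0 i) => [j|] ->; [have := kS j|]; rewrite ?mxE.
Qed.

(** Induction on the dimension: the phase is a first-coordinate phase plus a phase in the remaining
    coordinates, and the addition formulas separate the two. *)
Lemma Rintegral_cos_sin_phase {R : realType} d (k : 'rV[int]_d) :
  \int[cube_measure R d]_x cos (phase k x) = (k == 0)%:R /\
  \int[cube_measure R d]_x sin (phase k x) = 0.
Proof.
elim: d k => [|d IH] k.
  have phase0 x : phase k x = 0 :> R by rewrite /phase big_ord0 mulr0.
  under eq_Rintegral do rewrite phase0 cos0.
  under [X in _ /\ X = _]eq_Rintegral do rewrite phase0 sin0.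
  rewrite !Rintegral_cst// mul0r mul1r [k]thinmx0 eqxx.
  by split => //; rewrite [X in fine X](@probability_setT _ _ R).
have [C S] := @Rintegral_cos_sin_2pi R (k 0 ord0).
have [C' S'] := IH (\row_i k 0 (lift ord0 i)).
pose k' := \row_i k 0 (lift ord0 i).
rewrite !Rintegral_cubeS; [|exact: measurable_sin_phase|by move=> x; exact: sin_max
  |exact: measurable_cos_phase|by move=> x; exact: cos_max].
pose th x := 2 * pi * (x * (k 0 ord0)%:~R) : R.

(* By induction the sine of the remaining phase integrates to 0 and its cosine to the indicator of
   [k' = 0], so only one product survives. *)
have innerC (x : R) : \int[cube_measure R d]_y cos (phase k (cons_point (x, y))) =
    (k' == 0)%:R * cos (th x).
  have e y : cos (phase k (cons_point (x, y))) =
      cos (th x) * cos (phase k' y) + - sin (th x) * sin (phase k' y).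
    by rewrite phase_cons cosD mulNr.
  under eq_Rintegral do rewrite e.
  rewrite Rintegral_lincomb ?C' ?S' ?mulr0 ?addr0 1?mulrC//.
  - exact: integrable_cos_phase.
  - exact: integrable_sin_phase.
have innerS (x : R) : \int[cube_measure R d]_y sin (phase k (cons_point (x, y))) =
    (k' == 0)%:R * sin (th x).
  have e y : sin (phase k (cons_point (x, y))) =
      sin (th x) * cos (phase k' y) + cos (th x) * sin (phase k' y).
    by rewrite phase_cons sinD.
  under eq_Rintegral do rewrite e.
  rewrite Rintegral_lincomb ?C' ?S' ?mulr0 ?addr0 1?mulrC//.
  - exact: integrable_cos_phase.
  - exact: integrable_sin_phase.
under eq_Rintegral do rewrite innerC.
under [X in _ /\ X = _]eq_Rintegral do rewrite innerS.
have cth : continuous th.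
  by move=> x; apply: cvgM; [exact: cvg_cst|apply: cvgM => //; exact: cvg_cst].
have ci : (uniform_prob (@ltr01 R)).-integrable setT (EFin \o (fun x => cos (th x))).
  apply: bounded_integrable => [|x]; last exact: cos_max.
  by apply: continuous_measurable_fun => x; apply: continuous_comp;
    [exact: cth|exact: continuous_cos].
have si : (uniform_prob (@ltr01 R)).-integrable setT (EFin \o (fun x => sin (th x))).
  apply: bounded_integrable => [|x]; last exact: sin_max.
  by apply: continuous_measurable_fun => x; apply: continuous_comp;
    [exact: cth|exact: continuous_sin].
by rewrite !RintegralZl// C S mulr0 row_eq0_cons andbC -mulnb natrM.
Qed.


(** * Fourier coefficients of trigonometric polynomials *)

(** Integrability is proved together with the value because linearity of the integral needs it at
    each step of the induction. *)
Lemma torus_integral_trig_poly {R : realType} d (s : seq 'rV[int]_d) (c : 'rV[int]_d -> R[i]) :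
  let F x := \sum_(k <- s) c k * fourier_mode k x in
  [/\ (cube_measure R d).-integrable setT (EFin \o (fun x => complex.Re (F x))),
      (cube_measure R d).-integrable setT (EFin \o (fun x => complex.Im (F x))) &
      torus_integral F = \sum_(k <- s) c k * (k == 0)%:R].
Proof.
elim: s => [|k s [IR II IE]] /=.
  have i0 : (cube_measure R d).-integrable setT (EFin \o cst (0 : R)).
    by apply: bounded_integrable => [|x]; [exact: measurable_cst|rewrite normr0].
  have re0 : (fun x => complex.Re (\sum_(k <- [::]) c k * fourier_mode k x)) = cst (0 : R).
    by apply/funext => x; rewrite big_nil.
  have im0 : (fun x => complex.Im (\sum_(k <- [::]) c k * fourier_mode k x)) = cst (0 : R).
    by apply/funext => x; rewrite big_nil.
  by rewrite /torus_integral re0 im0 big_nil !Rintegral_cst// !mul0r.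
pose F x := \sum_(k <- s) c k * fourier_mode k x.
have [C S] := @Rintegral_cos_sin_phase R d k.
have ic := @integrable_cos_phase R d k.
have isn := @integrable_sin_phase R d k.
case ck : (c k) => [a b].
(* The factors [1 *] give the sum the shape of a nested linear combination. *)
have reE : (fun x => complex.Re (\sum_(k <- k :: s) c k * fourier_mode k x)) =
    (fun x => 1 * (a * cos (phase k x) + (- b) * sin (phase k x)) + 1 * complex.Re (F x)).
  apply/funext => x; rewrite big_cons -/(F x) ck; case: (F x) => u v /=; ring.
have imE : (fun x => complex.Im (\sum_(k <- k :: s) c k * fourier_mode k x)) =
    (fun x => 1 * (b * cos (phase k x) + a * sin (phase k x)) + 1 * complex.Im (F x)).
  apply/funext => x; rewrite big_cons -/(F x) ck; case: (F x) => u v /=; ring.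
rewrite /torus_integral reE imE; split; try by do 2 apply: integrable_lincomb => //.
rewrite !Rintegral_lincomb//; try exact: integrable_lincomb.
rewrite C S big_cons -IE /torus_integral ck.
by case: (k == 0); apply/eqP; rewrite eq_complex /=; apply/andP; split; apply/eqP; ring.
Qed.

Lemma fourier_modeB {R : realType} d (k j : 'rV[int]_d) (x : d.-tuple R) :
  fourier_mode k x * (fourier_mode j x)^* = fourier_mode (k - j) x.
Proof.
rewrite /fourier_mode /=.
have -> : phase (k - j) x = phase k x - phase j x.
  rewrite /phase -mulrBr -sumrB; congr (_ * _); apply: eq_bigr => i _.
  by rewrite !mxE intrD intrN mulrBr.
by rewrite cosB sinB; apply/eqP; rewrite eq_complex /=; apply/andP; split; apply/eqP; ring.
Qed.

(** Multiplying by the conjugate mode shifts every frequency by [- j], so the coefficient is the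
    mean of a trigonometric polynomial with frequencies [k - j]. *)
Lemma fourier_coef_trig_poly {R : realType} d (s : seq 'rV[int]_d)
    (c : 'rV[int]_d -> R[i]) (j : 'rV[int]_d) :
  fourier_coef (fun x => \sum_(k <- s) c k * fourier_mode k x) j =
  \sum_(k <- s) c k * (k == j)%:R.
Proof.
have [_ _] := @torus_integral_trig_poly R d [seq k - j | k <- s] (fun k => c (k + j)).
rewrite /fourier_coef big_map => E.
transitivity (\sum_(k <- s) c (k - j + j) * (k - j == 0)%:R); last first.
  by apply: eq_bigr => k _; rewrite subrK subr_eq0.
rewrite -E; congr torus_integral; apply/funext => x.
rewrite big_map mulr_suml; apply: eq_bigr => k _.
by rewrite subrK -mulrA fourier_modeB.
Qed.

Lemma fourier_coef_proj {R : realType} d (I : {fset 'rV[int]_d})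
    (f : d.-tuple R -> R[i]) (j : 'rV[int]_d) :
  fourier_coef (freq_proj I f) j = if j \in I then fourier_coef f j else 0.
Proof.
rewrite fourier_coef_trig_poly; case: ifPn => jI.
  rewrite (big_fsetD1 j)//= eqxx mulr1 big_seq big1 ?addr0// => k.
  by rewrite !inE => /andP[/negbTE -> _]; rewrite mulr0.
rewrite big_seq big1// => k kI; case: eqP => [kj|_]; last by rewrite mulr0.
by rewrite kj (negbTE jI) in kI.
Qed.

Lemma fourier_coef_mode {R : realType} d (k j : 'rV[int]_d) :
  fourier_coef (@fourier_mode R d k) j = (k == j)%:R.
Proof.
have := @fourier_coef_trig_poly R d [:: k] (fun=> 1) j.
rewrite big_seq1 mul1r => <-; congr fourier_coef.
by apply/funext => x; rewrite big_seq1 mul1r.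
Qed.

Lemma torus_L1_mode {R : realType} d (k : 'rV[int]_d) : torus_Lp 1%E (@fourier_mode R d k).
Proof.
split.
(* An integer translation [n] changes the phase by the period times the integer [n . k]. *)
- move=> x n; have E : phase k [tuple tnth x i + (n 0 i)%:~R | i < d] =
      phase k x + 2 * pi * (\sum_(i < d) n 0 i * k 0 i)%:~R.
    rewrite /phase -mulrDr rmorph_sum -big_split; congr (_ * _); apply: eq_bigr => i _ /=.
    by rewrite tnth_mktuple mulrDl intrM.
  by rewrite /fourier_mode E cosD2pi_int sinD2pi_int.
- exact/Lfun1_integrable/integrable_cos_phase.
- exact/Lfun1_integrable/integrable_sin_phase.
Qed.

(** * Finite sums: suprema, tails and Cauchy-Schwarz *)

(** [\esum] is a supremum of finite sums inside [D]; as [a] vanishes off [D], cutting [J] down to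
    [D] leaves its sum unchanged. *)
Lemma esum_leP {R : realType} {K : choiceType} (D : set K) (a : K -> R) (C : R) :
  (forall k, ~ D k -> a k = 0) ->
  (\esum_(k in D) (a k)%:E <= C%:E)%E <-> forall J : {fset K}, \sum_(k <- J) a k <= C.
Proof.
move=> aD; split=> [le_C J|le_C].
  rewrite -lee_fin; apply: le_trans le_C; apply: esum_ge.
  exists ([set` J] `&` D); first by split; [exact/finite_setIl/finite_fset|exact: subIsetr].
  have fJ : finite_set [set` J] by exact: finite_fset.
  have -> : (\sum_(k <- J) a k)%:E = (\sum_(k \in [set` J]) (a k)%:E)%E.
    by rewrite fsbig_finite// set_fsetK sumEFin.
  by rewrite (fsbigID D) //= [X in (_ + X)%E]fsbig1 ?adde0// => k [_ /aD ->].
apply: ge_ereal_sup => _ [X [finX _] <-].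
by rewrite fsbig_finite// sumEFin lee_fin.
Qed.

(** Choose [I] whose sum is within [e] of the supremum of all finite sums: what [J] adds outside [I]
    cannot exceed the gap. *)
Lemma summable_tail {R : realType} {K : choiceType} (a : K -> R) (C e : R) :
  (forall k, 0 <= a k) -> 0 < e -> (forall J : {fset K}, \sum_(k <- J) a k <= C) ->
  exists I : {fset K}, forall J : {fset K}, \sum_(k <- J | k \notin I) a k <= e.
Proof.
move=> a0 e0 leC; pose S := [set \sum_(k <- J) a k | J in [set: {fset K}]].
have hS : has_sup S.
  by split; [exists (\sum_(k <- fset0) a k), fset0|exists C => _ [J _ <-]].
have [_ [I _ <-] supI] := sup_adherent e0 hS.
exists I => J.
have : \sum_(k <- (J `|` I)%fset) a k <= sup S.
  by apply: ub_le_sup; [case: hS|exists (J `|` I)%fset].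
rewrite (big_fsetID _ (mem I)) /=.
have -> : [fset x in (J `|` I)%fset | x \in I]%fset = I.
  by apply/fsetP => k; rewrite !inE; case: (k \in I); rewrite ?andbF// orbT.
have -> : [fset x in (J `|` I)%fset | x \notin I]%fset = [fset x in J | x \notin I]%fset.
  by apply/fsetP => k; rewrite !inE; case: (k \in I); rewrite ?andbF// orbF.
rewrite [X in _ + X]big_fset/=; lra.
Qed.

Lemma sqrt_cauchy_schwarz {R : rcfType} {K : Type} (s : seq K) (a b : K -> R) :
  (forall k, 0 <= a k) -> (forall k, 0 <= b k) ->
  \sum_(k <- s) a k * b k <=
  Num.sqrt (\sum_(k <- s) a k ^+ 2) * Num.sqrt (\sum_(k <- s) b k ^+ 2).
Proof.
move=> a0 b0; elim: s => [|k s IH]; first by rewrite !big_nil mulr_ge0// sqrtr_ge0.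
rewrite !big_cons; apply: le_trans (lerD (lexx _) IH) _.
set A := \sum_(j <- s) a j ^+ 2; set B := \sum_(j <- s) b j ^+ 2.
have A0 : 0 <= A by apply: sumr_ge0 => j _; exact: sqr_ge0.
have B0 : 0 <= B by apply: sumr_ge0 => j _; exact: sqr_ge0.
rewrite -[leRHS]sqrtrM ?addr_ge0 ?sqr_ge0//.
rewrite -[leLHS]ger0_norm ?addr_ge0 ?mulr_ge0 ?sqrtr_ge0// -sqrtr_sqr ler_sqrt; last first.
  by rewrite mulr_ge0 ?addr_ge0 ?sqr_ge0.
set x := Num.sqrt A; set y := Num.sqrt B.
have <- : x ^+ 2 = A by exact: sqr_sqrtr.
have <- : y ^+ 2 = B by exact: sqr_sqrtr.
(* The inductive step is Cauchy-Schwarz for the two vectors [(a k, x)] and [(b k, y)], that is, the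
   Lagrange identity. *)
by have := sqr_ge0 (a k * y - b k * x); nra.
Qed.

Lemma cauchy_schwarz_le {R : rcfType} {K : Type} (s : seq K) (a b : K -> R) (A B : R) :
  (forall k, 0 <= a k) -> (forall k, 0 <= b k) -> 0 <= A -> 0 <= B ->
  \sum_(k <- s) a k ^+ 2 <= A ^+ 2 -> \sum_(k <- s) b k ^+ 2 <= B ^+ 2 ->
  \sum_(k <- s) a k * b k <= A * B.
Proof.
move=> a0 b0 A0 B0 leA leB; apply: le_trans (sqrt_cauchy_schwarz s a b a0 b0) _.
rewrite ler_pM ?sqrtr_ge0//.
  by rewrite -[leRHS]ger0_norm// -sqrtr_sqr ler_sqrt// sqr_ge0.
by rewrite -[leRHS]ger0_norm// -sqrtr_sqr ler_sqrt// sqr_ge0.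
Qed.

(** * Complex moduli, Sobolev norms and unconditional sums *)

Lemma normc_ge0 {R : rcfType} (z : R[i]) : 0 <= normc z.
Proof. by case: z => a b; exact: sqrtr_ge0. Qed.

Lemma normc_conj {R : rcfType} (z : R[i]) : normc z^* = normc z.
Proof. by case: z => a b /=; rewrite sqrrN. Qed.

Lemma Re_le_normc {R : rcfType} (z : R[i]) : `|complex.Re z| <= normc z.
Proof.
by case: z => a b /=; rewrite -sqrtr_sqr ler_sqrt ?addr_ge0 ?sqr_ge0// lerDl sqr_ge0.
Qed.

Lemma Im_le_normc {R : rcfType} (z : R[i]) : `|complex.Im z| <= normc z.
Proof.
by case: z => a b /=; rewrite -sqrtr_sqr ler_sqrt ?addr_ge0 ?sqr_ge0// lerDr sqr_ge0.
Qed.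

(** Square root of the summand of the squared norm, so that Cauchy-Schwarz applies directly to
    weights of opposite orders. *)
Definition sobolev_weight {R : realType} {d} (alpha : R) (f : d.-tuple R -> R[i]) k : R :=
  freq_norm R k `^ alpha * normc (fourier_coef f k).

Lemma freq_norm0 {R : realType} d : freq_norm R (0 : 'rV[int]_d) = 0.
Proof. by rewrite /freq_norm big1 ?sqrtr0// => i _; rewrite mxE expr0n. Qed.

Lemma freq_norm_gt0 {R : realType} d (k : 'rV[int]_d) : k != 0 -> 0 < freq_norm R k.
Proof.
move=> k0; rewrite sqrtr_gt0 lt_neqAle sumr_ge0 ?andbT; last by move=> i _; exact: sqr_ge0.
apply: contraNneq k0 => /esym/eqP; rewrite psumr_eq0; last by move=> i _; exact: sqr_ge0.
move=> /allP k0; apply/eqP/rowP => i; rewrite mxE.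
by have := k0 i (mem_index_enum i); rewrite sqrf_eq0 intr_eq0 => /eqP.
Qed.

Lemma sobolev_weight_ge0 {R : realType} d (alpha : R) (f : d.-tuple R -> R[i]) k :
  0 <= sobolev_weight alpha f k.
Proof. by rewrite mulr_ge0 ?powR_ge0 ?normc_ge0. Qed.

(* For [alpha != 0] the term [k = 0] excluded from the norm is [0 `^ alpha = 0],
   so the finite sums need no condition on [J]. *)
Lemma sobolev_norm_leP {R : realType} d (alpha M : R) (f : d.-tuple R -> R[i]) :
  alpha != 0 -> 0 <= M ->
  (sobolev_norm alpha f <= M%:E)%E <->
  forall J : {fset 'rV[int]_d}, \sum_(k <- J) sobolev_weight alpha f k ^+ 2 <= M ^+ 2.
Proof.
move=> alpha0 M0; rewrite -(esum_leP [set k | k != 0]); last first.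
  move=> k /negP; rewrite negbK => /eqP ->.
  by rewrite /sobolev_weight freq_norm0 powR0// mul0r expr0n.
rewrite /sobolev_norm.
have -> : (fun k => (freq_norm R k `^ (2 * alpha) * normc (fourier_coef f k) ^+ 2)%:E) =
    (fun k => (sobolev_weight alpha f k ^+ 2)%:E).
  by apply/funext => k; rewrite exprMn -(powR_mulrn 2 (powR_ge0 _ _)) -powRrM [alpha * _]mulrC.
set S := esum _ _; have : (0 <= S)%E by apply: esum_ge0 => k _; rewrite lee_fin sqr_ge0.
case: S => [s||] //=; rewrite ?lee_fin => s0.
  rewrite powR12_sqrt// -{1}[M]ger0_norm// -sqrtr_sqr ler_sqrt ?sqr_ge0//.
(* For an infinite sum both bounds fail: a power of [+oo] with nonzero exponent [2^-1] is [+oo]. *)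
by rewrite invr_eq0 pnatr_eq0.
Qed.

(* No summability is required: a net that diverges has [lim] equal to [point = 0]. *)
Lemma abs_sum_le {R : realType} {K : choiceType} (a : K -> R) (B : R) :
  0 <= B -> (forall J : {fset K}, \sum_(k <- J) `|a k| <= B) ->
  `|summability.sum (a : K -> R^o)| <= B.
Proof.
move=> B0 leB; rewrite /summability.sum.
have [cv|/dvgP ->] :=
  pselect (cvg (summability.partial_sum (a : K -> R^o) @ summability.totally));
  last by rewrite normr0.
have proper_tot := @summability.totally_filter K.
apply: (@closed_cvg _ _ _ proper_tot _ (fun x : R^o => `|x| <= B) _ _ _ cv).
- apply: (@closed_comp _ _ (@Num.norm R R^o) [set x | x <= B]); last exact: closed_le.
  by move=> x _; exact: norm_continuous.
- apply: nearW => J; rewrite /summability.partial_sum -(big_seq_fsetE _ _ xpredT).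
  by apply: le_trans (leB J); exact: ler_norm_sum.
Qed.

(** The net of partial sums is constant from [[fset k]] on. *)
Lemma sum_single {R : realType} {K : choiceType} (a : K -> R) (k : K) :
  (forall j, j != k -> a j = 0) -> summability.sum (a : K -> R^o) = a k.
Proof.
move=> ak; apply: lim_near_cst.
- exact: norm_hausdorff.
- exact: summability.totally_filter.
- exists [fset k]%fset => // J /=; rewrite fsub1set => kJ.
  rewrite /summability.partial_sum -(big_seq_fsetE _ _ xpredT) (big_fsetD1 k)//=.
  by rewrite big_seq big1 ?addr0// => j; rewrite !inE => /andP[jk _]; exact: ak.
Qed.

(** Real and imaginary parts are bounded separately, whence the factor 2; such a constant is
    harmless for the positivity of a limsup. *)
Lemma complex_sum_le {R : realType} d (a : 'rV[int]_d -> R[i]) (B : R) :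
  0 <= B -> (forall J : {fset 'rV[int]_d}, \sum_(k <- J) normc (a k) <= B) ->
  normc (complex_sum a) <= 2 * B.
Proof.
move=> B0 leB.
have re_le : `|complex.Re (complex_sum a)| <= B.
  by apply: abs_sum_le => // J; apply: le_trans (leB J);
    apply: ler_sum => k _; exact: Re_le_normc.
have im_le : `|complex.Im (complex_sum a)| <= B.
  by apply: abs_sum_le => // J; apply: le_trans (leB J);
    apply: ler_sum => k _; exact: Im_le_normc.
move: (complex_sum a) re_le im_le => [x y] /= xB yB.
rewrite -[leRHS]ger0_norm ?mulr_ge0// -sqrtr_sqr ler_sqrt ?sqr_ge0//.
rewrite -(real_normK (num_real x)) -(real_normK (num_real y)).
by have := normr_ge0 x; have := normr_ge0 y; nra.
Qed.

(** * Positive limsup and ratios of extended reals *)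

(** Both directions of the theorem argue by contraposition, so positivity is put as the failure of
    an eventual upper bound. *)
Lemma limf_esup_gt0P {R : realType} {T : choiceType} {X : filteredType T} (u : X -> \bar R)
    (F : set_system X) (FF : Filter F) :
  (0 < limf_esup u F)%E <->
  exists2 e : R, 0 < e & ~ (\forall t \near F, (u t <= e%:E)%E).
Proof.
split=> [u0|[e e0 ne]].
  apply: contrapT => ne; move: u0; apply/negP; rewrite -leNgt.
  apply/lee_addgt0Pr => e e0; rewrite add0e.
  have [//|ue] := pselect (\forall t \near F, (u t <= e%:E)%E); last by exfalso; apply: ne; exists e.
  (* The infimum defining the limsup is tested on the sublevel set itself. *)
  move=> ue; apply: le_trans (_ : _ <= ereal_sup (u @` [set t | (u t <= e%:E)%E]))%E _.
    by apply: ereal_inf_lbound; exists [set t | (u t <= e%:E)%E].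
  by apply: ge_ereal_sup => _ [t ut <-].
rewrite ltNge; apply/negP => u0; apply: ne.
have /ereal_inf_lt[_ [V FV <-] Ve] : (limf_esup u F < e%:E)%E by apply: le_lt_trans u0 _.
apply: filterS FV => t Vt; apply/ltW; apply: le_lt_trans Ve.
by apply: ereal_sup_ubound; exists t.
Qed.

Lemma sum_supp_le {R : realType} {K : choiceType} (v : K -> R) (I J : {fset K}) :
  (forall k, 0 <= v k) -> (forall k, k \notin I -> v k = 0) ->
  \sum_(k <- J) v k <= \sum_(k <- I) v k.
Proof.
move=> v0 vI; rewrite (big_fsetID _ (mem I) J) (big_fsetID _ (mem J) I) /=.
have -> : [fset x in J | x \in I]%fset = [fset x in I | x \in J]%fset.
  by apply/fsetP => k; rewrite !inE andbC.
rewrite lerD2l [X in X <= _]big_seq big1 ?sumr_ge0// => k.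
by rewrite !inE => /andP[_ /vI].
Qed.

(* At [n = +oo] the quotient is [0], since [(+oo)^-1 = 0] in [\bar R]. *)
Lemma ratio_le {R : realType} (x n : \bar R) (e : R) :
  (0 < n)%E -> 0 <= e -> (forall r, 0 < r -> n = r%:E -> (x <= (e * r)%:E)%E) ->
  (x / n <= e%:E)%E.
Proof.
case: n => [n||] //= n0 e0 xe; last by rewrite invey mule0 lee_fin.
have n0' : 0 < n by [].
by rewrite inver gt_eqF// lee_pdivrMr// -EFinM; exact: xe.
Qed.

Lemma le_of_ratio_le {R : realType} (x : \bar R) (n e : R) :
  0 < n -> (x / n%:E <= e%:E)%E -> (x <= (e * n)%:E)%E.
Proof. by move=> n0; rewrite inver gt_eqF// lee_pdivrMr// -EFinM. Qed.

(** * Estimates and exact values of the pairing *)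

(** The powers of order [q] and [- q] cancel for [k != 0]; at [k = 0] both sides vanish because [g]
    has mean zero. *)
Lemma normc_mul_weights {R : realType} d (q : R) (f g : d.-tuple R -> R[i]) k :
  mean_zero g ->
  normc (fourier_coef f k * (fourier_coef g k)^*) =
  sobolev_weight (- q) f k * sobolev_weight q g k.
Proof.
move=> g0; rewrite normcM normc_conj /sobolev_weight.
have [->|k0] := eqVneq k 0; first by rewrite g0 normc0 !mulr0.
have W0 : freq_norm R k `^ q != 0 by rewrite gt_eqF// powR_gt0// freq_norm_gt0.
by rewrite powRN; field.
Qed.

Lemma sobolev_weight_proj {R : realType} d (alpha : R) (I : {fset 'rV[int]_d})
    (f : d.-tuple R -> R[i]) k :
  sobolev_weight alpha (freq_proj I f) k = if k \in I then sobolev_weight alpha f k else 0.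
Proof. by rewrite /sobolev_weight fourier_coef_proj; case: ifP; rewrite ?normc0 ?mulr0. Qed.

(** The sum is split at [I]. Cauchy-Schwarz gives [A * G] for the frequencies in [I] and [N * delta]
    for the others; the 2 comes from [complex_sum_le]. *)
Lemma pairing_le {R : realType} d (q A N G delta : R) (I : {fset 'rV[int]_d})
    (f g : d.-tuple R -> R[i]) :
  0 < q -> 0 <= A -> 0 <= N -> 0 <= G -> 0 <= delta -> mean_zero g ->
  (sobolev_norm (- q) (freq_proj I f) <= A%:E)%E ->
  (sobolev_norm (- q) f <= N%:E)%E -> (sobolev_norm q g <= G%:E)%E ->
  (forall J : {fset 'rV[int]_d},
     \sum_(k <- J | k \notin I) sobolev_weight q g k ^+ 2 <= delta ^+ 2) ->
  normc (pairing f g) <= 2 * (A * G + N * delta).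
Proof.
move=> q0 A0 N0 G0 delta0 g0.
have qN0 : - q != 0 by rewrite oppr_eq0 gt_eqF.
have q0' : q != 0 by rewrite gt_eqF.
move=> /(sobolev_norm_leP _ _ _ _ qN0 A0) leA /(sobolev_norm_leP _ _ _ _ qN0 N0) leN.
move=> /(sobolev_norm_leP _ _ _ _ q0' G0) leG tail.
apply: complex_sum_le => [|J]; first by rewrite addr_ge0 ?mulr_ge0.
have termE k : normc (fourier_coef f k * (fourier_coef g k)^*) =
    sobolev_weight (- q) (freq_proj I f) k * sobolev_weight q g k +
    (if k \notin I then sobolev_weight (- q) f k * sobolev_weight q g k else 0).
  rewrite (normc_mul_weights _ q)// sobolev_weight_proj.
  by case: (k \in I); rewrite ?mul0r ?addr0 ?add0r.
rewrite (eq_bigr _ (fun k _ => termE k)) big_split -big_mkcond /=.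
apply: lerD; first by apply: cauchy_schwarz_le => // k; exact: sobolev_weight_ge0.
rewrite -big_filter; apply: cauchy_schwarz_le => //; try by move=> k; exact: sobolev_weight_ge0.
  rewrite big_filter; apply: le_trans (leN J); rewrite [leLHS]big_mkcond.
  by apply: ler_sum => k _; case: ifP => // _; exact: sqr_ge0.
by rewrite big_filter; exact: tail.
Qed.

(** Only the coefficient at [k] is nonzero, so the norm is bounded by that single weight. *)
Lemma in_Hdot_mode {R : realType} d (q : R) (k : 'rV[int]_d) :
  0 < q -> k != 0 -> in_Hdot q (@fourier_mode R d k).
Proof.
move=> q0 k0; split; first exact: torus_L1_mode.
  by rewrite /mean_zero fourier_coef_mode (negbTE k0).
apply: le_lt_trans (ltry (sobolev_weight q (@fourier_mode R d k) k)).
apply/sobolev_norm_leP => [||J]; [by rewrite gt_eqF|exact: sobolev_weight_ge0|].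
rewrite -[leRHS](big_seq_fset1 +%R k (fun k' => sobolev_weight q (fourier_mode k) k' ^+ 2)).
apply: sum_supp_le => [j|j]; first exact: sqr_ge0.
rewrite inE /sobolev_weight fourier_coef_mode eq_sym => /negbTE ->.
by rewrite normc0 mulr0 expr0n.
Qed.

Lemma pairing_mode {R : realType} d (k : 'rV[int]_d) (f : d.-tuple R -> R[i]) :
  pairing f (fourier_mode k) = fourier_coef f k.
Proof.
have a0 j : j != k -> fourier_coef f j * (fourier_coef (fourier_mode k) j)^* = 0.
  by rewrite fourier_coef_mode eq_sym => /negbTE ->; rewrite rmorph_nat mulr0.
rewrite /pairing /complex_sum (sum_single _ k); last by move=> j /a0 ->.
rewrite (sum_single _ k); last by move=> j /a0 ->.
by rewrite fourier_coef_mode eqxx rmorph_nat mulr1; case: (fourier_coef f k).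
Qed.

(** * The equivalence *)

Theorem theorem1 (R : realType) (d : nat) (T : set R) (hT : time_domain T)
    (q : R) (hq : 0 < q) (f : R -> d.-tuple R -> R[i])
    (hL2 : forall t, T t -> torus_Lp 2%:E (f t))
    (hmean : forall t, T t -> mean_zero (f t))
    (hpos : forall t, T t -> 0 < t -> (0 < sobolev_norm (- q) (f t))%E) :
  recurrent T q f <->
  exists g : d.-tuple R -> R[i],
    in_Hdot q g /\
    (0 < limsup_time T (fun t =>
       (normc (pairing (f t) g))%:E / sobolev_norm (- q) (f t)))%E.
Proof.
have FF : Filter (within T (pinfty_nbhs R)) by exact: within_filter.
(* Positivity of the norm is given only at positive times of [T], which is eventually the case. *)
have near_pos : \forall t \near within T (pinfty_nbhs R), T t /\ 0 < t.
  by exists 0; split; [exact: num_real|move=> t t0 Tt].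
have qN0 : - q != 0 by rewrite oppr_eq0 gt_eqF.
split=> [[I /limf_esup_gt0P [e e0 ne]]|[g [[_ g0 gfin] /limf_esup_gt0P [e e0 ne]]]].
  (* Recurrence to [g]: if no [g] works, each mode in [I] is eventually negligible, and then so is
     the projection. *)
  apply: contrapT => no_g; apply: ne.
  pose C := \sum_(k <- I) (freq_norm R k `^ (- q)) ^+ 2.
  have C0 : 0 <= C by apply: sumr_ge0 => k _; exact: sqr_ge0.
  (* Chosen so that [C * e' ^+ 2 <= e ^+ 2], by [C <= (C + 1) ^+ 2]; the [+ 1] keeps the denominator
     positive when [C = 0]. *)
  pose e' := e / (C + 1).
  have e'0 : 0 < e' by rewrite divr_gt0// ltr_wpDl.
  (* Frequency 0 is exempt since the constant mode does not have mean zero. *)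
  have small k : k \in I -> \forall t \near within T (pinfty_nbhs R), k != 0 ->
      ((normc (fourier_coef (f t) k))%:E / sobolev_norm (- q) (f t) <= e'%:E)%E.
    move=> _; have [k0|k0] := eqVneq k 0; first exact: nearW.
    apply: contrapT => nk; apply: no_g; exists (fourier_mode k).
    split; first exact: in_Hdot_mode.
    apply/limf_esup_gt0P; exists e' => //; apply: contra_not nk.
    by apply: filterS => t; rewrite pairing_mode.
  (* Finiteness of [I] makes the bounds for its frequencies hold simultaneously. *)
  have := filter_bigI FF small; apply: filterS2 near_pos => t [Tt t0] smallt.
  apply: ratio_le; [exact: hpos|exact: ltW|move=> n n0 En].
  apply/sobolev_norm_leP => // [|J]; first by rewrite mulr_ge0// ltW.
  apply: le_trans (sum_supp_le _ I _ _ _) _ => [k|k /negbTE kI|].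
  - exact: sqr_ge0.
  - by rewrite sobolev_weight_proj kI expr0n.
  apply: (@le_trans _ _ (\sum_(k <- I) (freq_norm R k `^ (- q)) ^+ 2 * (e' * n) ^+ 2)).
    rewrite big_seq [leRHS]big_seq; apply: ler_sum => k kI.
    (* At [k = 0] the weight vanishes by the convention that 0 to the nonzero power [- q] is 0. *)
    rewrite sobolev_weight_proj kI exprMn; have [->|k0] := eqVneq k 0.
      by rewrite freq_norm0 powR0// expr0n !mul0r.
    apply: ler_wpM2l; first exact: sqr_ge0.
    have := smallt k kI k0; rewrite En => /(le_of_ratio_le _ _ _ n0); rewrite lee_fin => le_n.
    by rewrite lerXn2r ?nnegrE ?normc_ge0// mulr_ge0// ltW.
  rewrite -mulr_suml -/C [(e' * n) ^+ 2]exprMn [(e * n) ^+ 2]exprMn mulrA ler_pM2r ?exprn_gt0//.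
  rewrite /e' expr_div_n mulrA ler_pdivrMr ?exprn_gt0// ?ltr_wpDl//.
  by have := sqr_ge0 e; nra.
(* From [g] to recurrence: [G] is the finite norm of [g], and [I] is then chosen to carry all but a
   small tail of it. *)
have [G G0 leG] : exists2 G : R, 0 <= G & (sobolev_norm q g <= G%:E)%E.
  have N0 : (0 <= sobolev_norm q g)%E by exact: poweR_ge0.
  by exists (fine (sobolev_norm q g)); [exact: fine_ge0|rewrite fineK// ge0_fin_numE].
have [I tail] : exists I : {fset 'rV[int]_d}, forall J : {fset 'rV[int]_d},
    \sum_(k <- J | k \notin I) sobolev_weight q g k ^+ 2 <= (e / 4) ^+ 2.
  apply: (summable_tail _ (G ^+ 2)) => [k||]; [exact: sqr_ge0|by rewrite exprn_gt0// divr_gt0|].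
  by apply/sobolev_norm_leP => //; rewrite gt_eqF.
(* With this [eta] both [eta * G] and the tail are at most [e / 4], so [pairing_le] yields
   [2 * (e / 4 + e / 4) * n = e * n]. *)
exists I; apply/limf_esup_gt0P; pose eta := e / (4 * (G + 1)).
have G1 : 0 < G + 1 by rewrite ltr_wpDl.
have eta0 : 0 < eta by rewrite divr_gt0// mulr_gt0.
exists eta => //; apply: contra_not ne; apply: filterS2 near_pos => t [Tt t0] le_eta.
apply: ratio_le; [exact: hpos|exact: ltW|move=> n n0 En].
move: le_eta; rewrite En => /(le_of_ratio_le _ _ _ n0) le_proj.
rewrite lee_fin; apply: le_trans (pairing_le _ q (eta * n) n G (e / 4) I _ _ _ _ _ _ _ _ _ _ _ _) _ => //.
- by rewrite mulr_ge0// ltW.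
- exact: ltW.
- by rewrite divr_ge0// ltW.
- by rewrite En.
have : eta * G <= e / 4.
  have -> : e / 4 = eta * (G + 1) by rewrite /eta; field; rewrite gt_eqF.
  by rewrite ler_pM2l// lerDl.
by nra.
Qed.
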